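(* Let $X$ be an $e$-open space. Then $X$ is locally contractible. In fact, if $p\in X$ and $U$ is any neighborhood of $p$ in $X$, then there is a neighborhood $V$ of $p$ which can be contracted to $p$ relative to $p$ within $U$; that is, $V\subseteq U$ and there is a continuous $H:V\times[0,1]\to U$ with $H(v,0)=v$ and $H(v,1)=p$ for all $v\in V$, and $H(p,t)=p$ for all $t\in[0,1]$.
   Context: ''Space'' means compact metrizable space and ''map'' means continuous function. A space pair is a pair $(Y,Z)$ where $Y$ is a space and $Z\subseteq Y$ is a closed subspace. For spaces $X,Z$, $X^Z$ denotes the set of maps from $Z$ to $X$ with the topology of uniform convergence (equivalently, the compact-open topology). For a space pair $(Y,Z)$, $X^{Z\uparrow Y}\subseteq X^Z$ denotes the set of maps from $Z$ to $X$ which extend to a map from $Y$ to $X$. A space $X$ is $e$-open if, for every space pair $(Y,Z)$, the set $X^{Z\uparrow Y}$ is open in $X^Z$. $X$ is locally contractible if for every $p\in X$ and every neighborhood $U$ of $p$ there is a neighborhood $V\subseteq U$ of $p$ such that the inclusion $V\to U$ is homotopic to a constant map. *)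

(* Defs.v *)
From mathcomp Require Import all_boot all_order all_algebra.
From mathcomp Require Import all_classical all_reals all_analysis.
Set Implicit Arguments.
Unset Strict Implicit.
Unset Printing Implicit Defensive.
Import Order.TTheory GRing.Theory Num.Theory.
Import numFieldNormedType.Exports.
Local Open Scope classical_set_scope.
Local Open Scope ring_scope.

Section Spaces.
Variable R : realType.

Definition is_distance (T : Type) (d : T -> T -> R) : Prop :=
  [/\ forall x y, 0 <= d x y,
      forall x y, d x y = 0 <-> x = y,
      forall x y, d x y = d y x &
      forall x y z, d x z <= d x y + d y z].

Definition metrizable (T : topologicalType) : Prop :=
  exists d : T -> T -> R, is_distance d /\
    forall (x : T) (A : set T),
      nbhs x A <-> exists2 e : R, 0 < e & [set y | d x y < e] `<=` A.

Definition compact_metrizable (T : topologicalType) : Prop :=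
  compact [set: T] /\ metrizable T.

(* A pair (Y, Z) is given by Z : set Y; the library coerces Z to the type
   set_type Z of its points, equipped with the topology induced by Y. *)
Definition space_pair (Y : topologicalType) (Z : set Y) : Prop :=
  compact_metrizable Y /\ closed Z.

Definition extendable (X Y : topologicalType) (Z : set Y) :
    set (continuousType Z X) :=
  [set f | exists g : continuousType Y X, forall z : Z, g (set_val z) = f z].

Section EOpen.
(* Makes continuousType Z X the space of maps with the compact-open topology;
   for Z compact and X metrizable, this is the topology of uniform convergence
   with respect to any distance inducing the topology of X. *)
Import ArrowAsCompactOpen.

Definition e_open (X : topologicalType) : Prop :=
  forall (Y : topologicalType) (Z : set Y),
    space_pair Z -> open (@extendable X Y Z).

End EOpen.

(* H is a homotopy from f to g, as maps from V to U, where U and V carry the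
   subspace topologies. The values of f, g outside V and of H outside
   V x [0, 1] are irrelevant. *)
Definition homotopy_within (X : topologicalType) (V U : set X)
    (f g : X -> X) (H : X * R -> X) : Prop :=
  [/\ {within V `*` `[0, 1], continuous H},
      forall v t, V v -> t \in `[0, 1] -> U (H (v, t)),
      forall v, V v -> H (v, 0) = f v &
      forall v, V v -> H (v, 1) = g v].

Definition locally_contractible (X : topologicalType) : Prop :=
  forall (p : X) (U : set X), nbhs p U ->
    exists V : set X, [/\ nbhs p V, V `<=` U &
      exists (q : X) (H : X * R -> X),
        U q /\ homotopy_within V U id (cst q) H].

End Spaces.

(* Main.v *)
Require Import Defs.
From mathcomp Require Import all_boot all_order all_algebra.
From mathcomp Require Import all_classical all_reals all_analysis.
From mathcomp Require Import lra.
Set Implicit Arguments.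
Unset Strict Implicit.
Unset Printing Implicit Defensive.
Import Order.TTheory GRing.Theory Num.Theory.
Import numFieldNormedType.Exports.
Local Open Scope classical_set_scope.
Local Open Scope ring_scope.

(** Contracting a small ball B(p, s) to p rel p means extending to the cylinder
    B(p, s) x [0, 1] the map given by the identity on the bottom, and by p on
    the top and on the axis {p} x [0, 1]. For small s this map is uniformly
    close to the constant map p, which extends; but e-openness applied to one
    cylinder gives a notion of closeness that depends on the cylinder, and it
    does not keep the extension inside U. Both defects disappear when all the
    cylinders are put into one space pair.

    Let Y = [0, 1] x X x [0, 1], with points (s, x, t), and let Z be the set of
    those points for which s is 0 or some 1/(n+1) (the scales) and either x = p
    or d(p, x) <= s with t = 0 or t = 1. Let f_N send (s, x, t) to x when
    s <= 1/(N+2) and t = 0, and to p otherwise. No scale lies strictly between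
    1/(N+2) and 1/(N+1), so f_N is continuous on Z
    ([bottom_embedding_continuous]). It differs from p by at most 1/(N+2), and
    the constant map p extends to Y, so e-openness makes f_N extend to some
    g : Y -> X for a suitable N ([bottom_embedding_extends]). This single g
    contracts all the small balls at once, and it equals p on the limit segment
    {(0, p)} x [0, 1]. By compactness of that segment, g maps
    {1/(n+1)} x B(p, r) x [0, 1] into U for large n and small r ([near_tube]);
    restricting to the ball of radius min(r, 1/(n+1)) gives the homotopy. *)

(** * Continuity and metrizability *)

Lemma continuous_pair (T U V : topologicalType) (f : T -> U) (g : T -> V) :
  continuous f -> continuous g -> continuous (fun x => (f x, g x)).
Proof. by move=> cf cg x; exact: (cvg_pair (cf x) (cg x)). Qed.

Lemma within_eq_continuous (T U : topologicalType) (A : set T) (f g : T -> U) :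
  {in A, f =1 g} -> continuous f -> {within A, continuous g}.
Proof.
move=> fg /continuous_subspaceT cf.
by apply: (subspace_eq_continuous fg); exact: cf.
Qed.

Lemma closed_le_continuous (R : realType) (T : topologicalType) (f g : T -> R) :
  continuous f -> continuous g -> closed [set y | f y <= g y].
Proof.
move=> cf cg; rewrite (_ : mkset _ = (g \- f) @^-1` [set r | 0 <= r]).
  apply: closed_comp; last exact: closed_ge.
  by move=> y _; apply: continuousB; [exact: cg|exact: cf].
by apply/seteqP; split=> y /=; rewrite subr_ge0.
Qed.

Lemma closed_eq_continuous (R : realType) (T : topologicalType) (f g : T -> R) :
  continuous f -> continuous g -> closed [set y | f y = g y].
Proof.
move=> cf cg.
rewrite (_ : mkset _ = [set y | f y <= g y] `&` [set y | g y <= f y]).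
  by apply: closedI; exact: closed_le_continuous.
apply/seteqP; split=> y /=; first by move=> ->.
by move=> [h h']; apply/eqP; rewrite eq_le h.
Qed.

Section Metrizability.
Variable R : realType.

Definition metrizes (X : topologicalType) (d : X -> X -> R) : Prop :=
  is_distance d /\
  forall x A, nbhs x A <-> exists2 e : R, 0 < e & [set y | d x y < e] `<=` A.

Lemma distance_continuous (X : topologicalType) (d : X -> X -> R) (p : X) :
  metrizes d -> continuous (d p).
Proof.
move=> [[_ _ dC dT] dN] x; apply/cvgrPdist_lt => e e0.
apply/dN; exists e => // y /= xye; apply: le_lt_trans xye.
have := dT p x y; have := dT p y x; rewrite (dC y x) => h h'.
by rewrite ler_norml; apply/andP; split; lra.
Qed.

Lemma compact_metrizable_prod (X Y : topologicalType) :
  compact_metrizable R X -> compact_metrizable R Y ->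
  compact_metrizable R (X * Y)%type.
Proof.
move=> [cX [d [[d0 dE dC dT] dN]]] [cY [d' [[d'0 d'E d'C d'T] d'N]]]; split.
  by rewrite -setXTT; exact: compact_setX.
exists (fun z w => Num.max (d z.1 w.1) (d' z.2 w.2)); split.
  split.
  - by move=> z w; rewrite le_max d0.
  - move=> [x y] [x' y'] /=; split=> [m0|[<- <-]]; last first.
      by rewrite (dE x x).2 // (d'E y y).2 // maxxx.
    have: Num.max (d x x') (d' y y') <= 0 by rewrite m0.
    rewrite ge_max => /andP[dx dy].
    by congr (_, _); [apply/dE|apply/d'E]; apply/eqP;
      rewrite eq_le ?dx ?dy ?d0 ?d'0.
  - by move=> z w; rewrite dC d'C.
  - move=> z w v; rewrite ge_max; apply/andP; split.
      by apply: le_trans (dT _ w.1 _) _; rewrite lerD // le_max lexx.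
    by apply: le_trans (d'T _ w.2 _) _; rewrite lerD // le_max lexx orbT.
move=> [x y] A; split.
  move=> [[P Q] /= [/dN [e e0 eP] /d'N [e' e'0 eQ]] PQA].
  exists (Num.min e e'); first by rewrite lt_min e0.
  move=> [x' y'] /=; rewrite gt_max !lt_min => /andP[/andP[h _] /andP[_ h']].
  by apply: PQA; split; [exact: eP|exact: eQ].
move=> [e e0 eA]; exists ([set x' | d x x' < e], [set y' | d' y y' < e]).
  by split; [apply/dN; exists e|apply/d'N; exists e].
by move=> [x' y'] /= [h h']; apply: eA; rewrite /= gt_max h.
Qed.

Definition unit_interval : set R := `[0, 1]%classic.

Lemma clamp_subproof (t : R) : Num.max 0 (Num.min 1 t) \in unit_interval.
Proof.
by rewrite inE /unit_interval /= in_itv /= le_max lexx ge_max ler01 ge_min lexx.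
Qed.

(** The retraction of the line onto the interval. It turns real parameters into
    points of the interval without proof obligations, so that the homotopy can
    be a total continuous function of a real time. *)
Definition clamp (t : R) : unit_interval :=
  exist _ (Num.max 0 (Num.min 1 t)) (clamp_subproof t).

Lemma clampK (t : R) : 0 <= t <= 1 -> set_val (clamp t) = t.
Proof.
by move=> /andP[t0 t1]; rewrite set_valE /=; rewrite (min_idPr t1) (max_idPr t0).
Qed.

Lemma clamp_val (s : unit_interval) : clamp (set_val s) = s.
Proof.
apply: val_inj => /=; apply: clampK.
by have := set_valP s; rewrite /unit_interval /= in_itv.
Qed.

Lemma clamp_continuous : continuous clamp.
Proof.
apply: continuous_comp_initial => t; apply: continuous_max; first exact: cvg_cst.
by apply: continuous_min; [exact: cvg_cst|exact: cvg_id].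
Qed.

Lemma compact_metrizable_unit_interval : compact_metrizable R unit_interval.
Proof.
split.
  suff <- : clamp @` unit_interval = setT.
    apply: continuous_compact; last exact: segment_compact.
    exact/continuous_subspaceT/clamp_continuous.
  rewrite -subTset => s _; exists (set_val s); last exact: clamp_val.
  exact: set_valP.
exists (fun s t => `|set_val s - set_val t|); split.
  split => [s t|s t|s t|s t u].
  - exact: normr_ge0.
  - split=> [/eqP|->]; last by rewrite subrr normr0.
    by rewrite normr_eq0 subr_eq0 => /eqP/val_inj.
  - exact: distrC.
  - exact: ler_distD.
(* The canonical balls of the subtype are, up to conversion, the sets
   [set t | `|set_val s - set_val t| < e]. *)
by move=> s A; split=> [/nbhs_ballP|] [e /= e0 eA];
  last apply/nbhs_ballP; exists e.
Qed.

End Metrizability.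

Arguments unit_interval : clear implicits.

(** * Neighborhoods of a constant map *)

Section ConstantMap.
Import ArrowAsCompactOpen.

(** A subbasic set of maps sending a compact K into an open W contains a
    constant map p only if p is in W or K is empty; so the maps with values in
    small neighborhoods of p converge to it, whatever the source Z. *)
Lemma open_nbhs_constant_map (Z X : topologicalType) (p : X)
    (A : set (continuousType Z X)) (c : continuousType Z X) :
  open A -> A c -> (forall z, c z = p) ->
  exists2 V, nbhs p V &
    forall f : continuousType Z X, (forall z, V (f z)) -> A f.
Proof.
move=> [B oB BA] Ac cp.
pose F : set_system {compact-open, Z -> X} :=
  filter_from (nbhs p) (fun V => [set f | forall z, V (f z)]).
have FF : Filter F.
  apply: filter_from_filter; first by exists setT; exact: filterT.
  move=> V W pV pW; exists (V `&` W); first exact: filterI.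
  by move=> f fVW; split => z; case: (fVW z).
have Fc : F --> (c : {compact-open, Z -> X}).
  apply/compact_open_cvgP => K W _ oW cKW.
  (* When K is empty, W need not contain p and every map qualifies. *)
  exists (W `|` [set x | K = set0]).
    have [->|/set0P[z Kz]] := eqVneq K set0.
      by apply: filterS filterT; right.
    apply: filterS (open_nbhs_nbhs (conj oW _)); first by left.
    by apply: cKW; exists z.
  move=> f fW _ [z Kz <-]; case: (fW z) => // K0.
  by move: Kz; rewrite K0.
have : F B by apply: Fc; apply: open_nbhs_nbhs; split => //; move: Ac; rewrite -BA.
by case=> V pV VB; exists V => // f fV; rewrite -BA; exact: VB.
Qed.

End ConstantMap.

(** * The shrinking sequence of cylinders *)

Section Cylinders.
Variables (R : realType) (X : topologicalType) (d : X -> X -> R) (p : X).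
Hypothesis metrd : metrizes d.

Local Notation I := (unit_interval R).

(** Inside [0, 1] this is {0} together with all the 1/(n+1). Describing it by
    its gaps makes it visibly closed, and exhibits each gap as a place where a
    continuous function may jump. *)
Definition scales : set R :=
  [set u | forall n, u <= harmonic n.+1 \/ harmonic n <= u].

Definition cylinder_boundaries : set (I * X * I)%type :=
  [set y | scales (set_val y.1.1) /\
    (y.1.2 = p \/
     d p y.1.2 <= set_val y.1.1 /\ (set_val y.2 = 0 \/ set_val y.2 = 1))].

Local Notation Z := cylinder_boundaries.

Definition bottom_embedding (N : nat) (y : I * X * I) : X :=
  if (set_val y.1.1 <= harmonic N.+1) && (set_val y.2 == 0) then y.1.2 else p.

Lemma ler_harmonic (m n : nat) : (harmonic m <= harmonic n :> R) = (n <= m)%N.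
Proof. by rewrite lef_pV2 ?posrE ?ltr0n // ler_nat. Qed.

Lemma scales0 : scales 0.
Proof. by move=> n; left; exact: harmonic_ge0. Qed.

Lemma scales_harmonic (n : nat) : scales (harmonic n).
Proof.
by move=> m; have [mn|nm] := ltnP m n; [left|right]; rewrite ler_harmonic.
Qed.

Let scale_continuous : continuous (fun y : I * X * I => set_val y.1.1).
Proof.
move=> y; apply: (@continuous_comp _ I _ (fun y : I * X * I => y.1.1) set_val).
  by apply: continuous_comp; exact: cvg_fst.
exact: initial_continuous.
Qed.

Let point_continuous : continuous (fun y : I * X * I => y.1.2).
Proof. by move=> y; apply: continuous_comp; [exact: cvg_fst|exact: cvg_snd]. Qed.

Let radius_continuous : continuous (fun y : I * X * I => d p y.1.2).
Proof.
move=> y; apply: continuous_comp; first exact: point_continuous.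
exact: distance_continuous.
Qed.

Let height_continuous : continuous (fun y : I * X * I => set_val y.2).
Proof.
move=> y; apply: (@continuous_comp _ I _ snd set_val); first exact: cvg_snd.
exact: initial_continuous.
Qed.

Let closed_axis : closed [set y : I * X * I | y.1.2 = p].
Proof.
rewrite (_ : mkset _ = [set y | d p y.1.2 = 0]).
  by apply: closed_eq_continuous => // y; exact: cvg_cst.
by case: metrd => -[_ dE _ _] _; apply/seteqP; split=> y /=; rewrite dE.
Qed.

Lemma closed_cylinder_boundaries : closed Z.
Proof.
rewrite (_ : Z = \bigcap_n ([set y | set_val y.1.1 <= harmonic n.+1] `|`
    [set y | harmonic n <= set_val y.1.1]) `&` ([set y | y.1.2 = p] `|`
    [set y | d p y.1.2 <= set_val y.1.1] `&`
    ([set y | set_val y.2 = 0] `|` [set y | set_val y.2 = 1]))); last first.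
  by apply/seteqP; split=> y /= [h h']; split => // n; [move=> _|]; exact: h.
apply: closedI.
  by apply: closed_bigI => n _; apply: closedU;
    apply: closed_le_continuous => // y; exact: cvg_cst.
apply: closedU => //; apply: closedI; first exact: closed_le_continuous.
by apply: closedU; apply: closed_eq_continuous => // y; exact: cvg_cst.
Qed.

(** The gap between the scales 1/(N+2) and 1/(N+1) separates the cylinders
    whose bottom is embedded from those that are collapsed, and the bottoms
    meet the rest of Z only on the axis, where both formulas give p. *)
Lemma bottom_embedding_continuous (N : nat) :
  {within Z, continuous (bottom_embedding N)}.
Proof.
set low := [set y : I * X * I | set_val y.1.1 <= harmonic N.+1] `&`
  [set y | set_val y.2 = 0].
set rest := [set y : I * X * I | harmonic N <= set_val y.1.1] `|`
  ([set y | y.1.2 = p] `|` [set y | set_val y.2 = 1]).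
have sub : Z `<=` low `|` rest.
  move=> y [/(_ N) [] yN [yp|[_ []] y2]]; rewrite /low /rest /=; tauto.
apply: (continuous_subspaceW sub).
apply: withinU_continuous.
- by apply: closedI; [apply: closed_le_continuous|apply: closed_eq_continuous];
    rewrite // => y; exact: cvg_cst.
- apply: closedU; first by apply: closed_le_continuous => // y; exact: cvg_cst.
  by apply: closedU => //; apply: closed_eq_continuous => // y; exact: cvg_cst.
- apply: (@within_eq_continuous _ _ _ (fun y : I * X * I => y.1.2)) => //.
  move=> y /set_mem [yN] /= y2.
  by rewrite /bottom_embedding y2 eqxx andbT ifT.
- apply: (@within_eq_continuous _ _ _ (cst p)); last by move=> y; exact: cvg_cst.
  move=> y /set_mem [yN|[/= yp|/= y2]]; rewrite /bottom_embedding.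
  + by rewrite leNgt (lt_le_trans _ yN) // ltNge ler_harmonic ltnn.
  + by rewrite yp if_same.
  + by rewrite y2 oner_eq0 andbF.
Qed.

Lemma bottom_embedding_extends :
  compact_metrizable R X -> e_open R X ->
  exists N (g : continuousType (I * X * I)%type X),
    forall y, Z y -> g y = bottom_embedding N y.
Proof.
move=> spaceX eopenX.
have [[_ dE _ _] dN] := metrd.
have spaceZ : space_pair R Z.
  split; last exact: closed_cylinder_boundaries.
  have spaceI := compact_metrizable_unit_interval R.
  by do 2?apply: compact_metrizable_prod.
have cp (T : topologicalType) : continuous (cst p : T -> X).
  by move=> ?; exact: cvg_cst.
have [||V pV VZ] := @open_nbhs_constant_map Z X p _ (mkcts (cp Z))
  (eopenX _ _ spaceZ).
- by exists (mkcts (cp _)).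
- by [].
have [e e0 eV] := (dN _ _).1 pV.
have /cvgrPdist_lt /(_ _ e0)[N _ /(_ N (leqnn N))] := @cvg_harmonic R.
rewrite sub0r normrN ger0_norm ?harmonic_ge0// => Ne.
have cf : continuous (sigL Z (bottom_embedding N)).
  exact/subspace_sigL_continuousP/bottom_embedding_continuous.
have small y : Z y -> d p (bottom_embedding N y) < e.
  move=> [_ yZ]; rewrite /bottom_embedding.
  case: ifP => [/andP[yN _]|_]; last by rewrite (dE p p).2.
  apply: le_lt_trans Ne; case: yZ => [->|[h _]].
    by rewrite (dE p p).2 // harmonic_ge0.
  by apply: le_trans h (le_trans yN _); rewrite ler_harmonic.
have [z|g gf] := VZ (mkcts cf).
  by apply: eV; exact: small (set_valP z).
by exists N, g => y /mem_set Zy; exact: (gf (exist _ y Zy)).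
Qed.

(** The tube lemma for the compact segment {(s, p)} x [0, 1]. *)
Lemma near_tube (g : I * X * I -> X) (s : I) (U : set X) :
  continuous g -> (forall t, nbhs (g (s, p, t)) U) ->
  \forall z \near (s, p), forall t, U (g (z, t)).
Proof.
move=> cg gU.
have [cI _] := compact_metrizable_unit_interval R.
have /(_ _ (nbhs (s, p)) (fun z t => U (g (z, t))) _) tube :=
  (compact_near_coveringP _).1 cI.
have {}tube : \forall z \near (s, p), [set: I] `<=` (fun t => U (g (z, t))).
  apply: tube => t _.
  have [[P Q] [/= sP tQ] PQU] := cg (s, p, t) U (gU t).
  exists (Q, P) => // -[t' z] [/= Qt' Pz].
  by apply: (PQU (z, t')).
by apply: filterS tube => z zU t; exact: zU.
Qed.

(** The homotopy is the slice at scale 1/(n+1) of an extension g of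
    [bottom_embedding N]. The index n must exceed N for the slice to start at
    the identity, and be large enough for the slice to stay in U, which it does
    because g equals p on the limit segment at scale 0. *)
Lemma contractible_rel_point (U : set X) :
  compact_metrizable R X -> e_open R X -> nbhs p U ->
  exists V : set X, [/\ nbhs p V, V `<=` U &
    exists2 H : X * R -> X,
      homotopy_within V U id (cst p) H &
      forall t : R, t \in `[0, 1] -> H (p, t) = p].
Proof.
move=> spaceX eopenX pU; have [_ dN] := metrd.
have [N [g gf]] := bottom_embedding_extends spaceX eopenX.
pose s0 : I := clamp 0; pose h n : I := clamp (@harmonic R n).
have s0E : set_val s0 = 0 by rewrite clampK ?lexx ?ler01.
have hE n : set_val (h n) = harmonic n.
  by rewrite clampK // harmonic_ge0 /= invf_le1 ?ltr0n // ler1n.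
have hS n : scales (set_val (h n)) by rewrite hE; exact: scales_harmonic.
have gp s t : scales (set_val s) -> g (s, p, t) = p.
  by move=> sS; rewrite gf /bottom_embedding /= ?if_same //; split=> //; left.
have [|[P Q] [/= sP pQ] PQU] := @near_tube g s0 U (@cts_fun _ _ g).
  by move=> t; rewrite gp // s0E; exact: scales0.
have [n [hnP Nn]] : exists n, P (h n) /\ (N < n)%N.
  have : h n @[n --> \oo] --> s0.
    by apply: continuous_cvg; [exact: clamp_continuous|exact: cvg_harmonic].
  move=> /(_ _ sP)[M _ MP]; exists (maxn M N.+1).
  by split; [apply: MP => /=; rewrite leq_maxl|rewrite leq_maxr].
pose H (z : X * R) := g (h n, z.1, clamp z.2).
have cH : continuous H.
  have c1 : continuous (fun z : X * R => (h n, z.1)).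
    by apply: continuous_pair => z; [exact: cvg_cst|exact: cvg_fst].
  have c2 : continuous (fun z : X * R => clamp z.2).
    by move=> z; apply: continuous_comp; [exact: cvg_snd|exact: clamp_continuous].
  move=> z; apply: (@continuous_comp _ _ _ (fun z => (h n, z.1, clamp z.2)) g).
    exact: continuous_pair c1 c2 z.
  exact: cts_fun.
have HE v t : d p v <= harmonic n -> t = 0 \/ t = 1 ->
    H (v, t) = if t == 0 then v else p.
  move=> vn t01; have tI : set_val (clamp t) = t.
    by case: t01 => ->; rewrite clampK ?lexx ?ler01.
  have Zt : Z (h n, v, clamp t).
    by split; [exact: hS|right; rewrite /= hE tI].
  by rewrite /H gf //= /bottom_embedding /= hE tI ler_harmonic Nn.
have H0 v : d p v <= harmonic n -> H (v, 0) = v.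
  by move=> vn; rewrite HE ?eqxx //; left.
have HU v t : Q v -> U (H (v, t)) by move=> Qv; apply: (PQU (h n, v)).
exists ([set v | d p v < harmonic n] `&` Q); split.
- apply: filterI => //; apply/dN; exists (harmonic n) => //.
  exact: harmonic_gt0.
- by move=> v [/ltW vn Qv]; rewrite -(H0 v) //; exact: HU.
exists H; last by move=> t _; exact: gp.
split.
- exact: continuous_subspaceT.
- by move=> v t [_ Qv] _; exact: HU.
- by move=> v [/ltW vn _]; exact: H0.
- by move=> v [/ltW vn _]; rewrite HE ?oner_eq0 //; right.
Qed.

End Cylinders.

Theorem corollary4p3 (R : realType) (X : topologicalType)
    (spaceX : compact_metrizable R X) (eopenX : e_open R X) :
  locally_contractible R X /\
  forall (p : X) (U : set X), nbhs p U ->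
    exists V : set X, [/\ nbhs p V, V `<=` U &
      exists2 H : X * R -> X,
        homotopy_within V U id (cst p) H &
        forall t : R, t \in `[0, 1] -> H (p, t) = p].
Proof.
have [_ [d metrd]] := spaceX.
split=> p U pU; have [V [pV VU [H Hh Hp]]] :=
  contractible_rel_point metrd spaceX eopenX pU; last by exists V; split=> //; exists H.
by exists V; split=> //; exists p, H; split=> //; exact: nbhs_singleton.
Qed.
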